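(* Let $\mu$ and $\nu$ be measures on the measurable space $(\Omega,\Sigma)$. Assume that the pair $(\mu,\nu)$ is compatible on $(\Omega,\Sigma)$ and that $A\in\mathcal{F}_\mu\cap\mathcal{F}_\nu$. Let $h_A\in\mathcal{H}_{\int d\mu\le\nu}$ be a function such that $\int_A h_A\,d\mu=\sup\left\{\int_A h\,d\mu : h\in\mathcal{H}_{\int d\mu\le\nu}\right\}$. Then $$\nu(A)=\int_A h_A\,d\mu=\sup\left\{\int_A h\,d\mu : h\in\mathcal{H}_{\int d\mu\le\nu}\right\}.$$
   Context: Measures take values in $[0,+\infty]$, with no finiteness assumption. For a measure $\mu$ put $\mathcal{F}_\mu=\{A\in\Sigma:\mu(A)<+\infty\}$; similarly $\mathcal{F}_\nu$. $\mathcal{H}_{\int d\mu\le\nu}$ denotes the set of all measurable functions $h:\Omega\to[0,\infty]$ such that $\{h>0\}\in\mathcal{F}_\mu$ and $\int_M h\,d\mu\le\nu(M)$ for all $M\in\Sigma$. For each $A\in\mathcal{F}_\mu\cap\mathcal{F}_\nu$, a function $h_A\in\mathcal{H}_{\int d\mu\le\nu}$ attaining the supremum in the claim exists. Compatible: the pair $(\mu,\nu)$ is compatible on $(\Omega,\Sigma)$ if for every $A\in\Sigma$ with $0<\nu(A)<+\infty$ there exists $B\in\Sigma$ with $B\subseteq A$, $0<\nu(B)$ and $0<\mu(B)<+\infty$. *)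

(* Defs.v *)
From HB Require Import structures.
From mathcomp Require Import all_boot all_order all_algebra.
From mathcomp Require Import all_classical all_reals all_analysis.
From mathcomp Require Import measurable_realfun.
Set Implicit Arguments.
Unset Strict Implicit.
Unset Printing Implicit Defensive.
Import Order.TTheory GRing.Theory Num.Theory.
Local Open Scope classical_set_scope.
Local Open Scope ring_scope.
Local Open Scope ereal_scope.

Definition finite_measure_sets (d : measure_display) (T : measurableType d)
    (R : realType) (mu : {measure set T -> \bar R}) : set (set T) :=
  [set A | measurable A /\ mu A < +oo].

Definition int_le_class (d : measure_display) (T : measurableType d)
    (R : realType) (mu nu : {measure set T -> \bar R}) : set (T -> \bar R) :=
  [set h : T -> \bar R | [/\ measurable_fun setT h,
               forall x, 0 <= h x,
               finite_measure_sets mu [set x | 0 < h x] &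
               forall M, measurable M -> \int[mu]_(x in M) h x <= nu M]].

Definition compatible (d : measure_display) (T : measurableType d)
    (R : realType) (mu nu : {measure set T -> \bar R}) : Prop :=
  forall A, measurable A -> 0 < nu A -> nu A < +oo ->
    exists B, [/\ measurable B, B `<=` A, 0 < nu B, 0 < mu B & mu B < +oo].

(* Main.v *)
Require Import Defs.
From HB Require Import structures.
From mathcomp Require Import all_boot all_order all_algebra.
From mathcomp Require Import all_classical all_reals all_analysis.
From mathcomp Require Import measurable_realfun.
Import Order.TTheory GRing.Theory Num.Theory.
Local Open Scope classical_set_scope.
Local Open Scope ring_scope.
Local Open Scope ereal_scope.

(** Every member of the class integrates over [A] to at most [nu A], so only
    [nu A <= \int[mu]_(x in A) hA x] is at stake. Compatibility yields
    absolute continuity on sets of finite [nu]-measure: a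
    [mu]-null set of positive finite [nu]-measure would contain a set of
    positive [mu]-measure ([compatible_null]). Since [mu] and [nu] are both
    finite on [A], the Radon-Nikodym theorem applies to their restrictions to
    [A] and gives a density ([exists_density_on]). Extended by zero outside
    [A], this density lies in the class and integrates over [A] to exactly
    [nu A]; as [hA] attains the supremum over the class, the missing inequality
    follows. *)

Lemma compatible_null (d : measure_display) (T : measurableType d)
    (R : realType) (mu nu : {measure set T -> \bar R}) (N : set T) :
  compatible mu nu -> measurable N -> nu N < +oo -> mu N = 0 -> nu N = 0.
Proof.
move=> compat mN nuNoo muN0; apply/eqP; rewrite eq_le measure_ge0 andbT leNgt.
apply/negP => nuN_gt0.
have [B [mB BN _ muB_gt0 _]] := compat N mN nuN_gt0 nuNoo.
by move: muB_gt0; rewrite (subset_measure0 mB mN BN muN0) ltxx.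
Qed.

(** A Radon-Nikodym theorem for arbitrary measures, localized to a set on which
    both are finite: truncating the density to [A] turns integrals against
    [mu] over any [M] into integrals against the restricted, finite measure. *)
Lemma exists_density_on (d : measure_display) (T : measurableType d)
    (R : realType) (mu nu : {measure set T -> \bar R}) (A : set T) :
  measurable A -> mu A < +oo -> nu A < +oo ->
  (forall N, measurable N -> N `<=` A -> mu N = 0 -> nu N = 0) ->
  exists h : T -> \bar R,
    [/\ measurable_fun setT h, forall x, 0 <= h x,
        [set x | 0 < h x] `<=` A &
        forall M, measurable M -> \int[mu]_(x in M) h x = nu (M `&` A)].
Proof.
move=> mA muAoo nuAoo null.
pose muA : {finite_measure set T -> \bar R} := mfrestr mA muAoo.
pose nuA : {finite_measure set T -> \bar R} := mfrestr mA nuAoo.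
have nuA_muA : nuA `<< muA.
  apply/null_content_dominatesP => S mS muS0.
  exact: null (measurableI _ _ mS mA) (@subIsetr _ S A) muS0.
have [f [f_ge0 _ /integrableP[mf _] nuAE]] :=
  @radon_nikodym_sigma_finite _ _ _ muA nuA nuA_muA.
exists (f \_ A); split.
- by apply/(measurable_restrictT f mA); exact: measurable_funTS.
- by move=> x; rewrite patchE; case: ifP.
- by move=> x /=; rewrite patchE; case: ifPn; rewrite ?ltxx// inE.
- move=> M mM; rewrite -integral_mkcondr.
  rewrite (@eq_measure_integral _ _ _ (M `&` A) muA); last first.
    move=> S mS; rewrite subsetI => -[_ SA].
    by rewrite /muA /= /mfrestr /mrestr setIidl.
  rewrite -nuAE; last exact: measurableI.
  by rewrite /nuA /= /mfrestr /mrestr -setIA setIid.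
Qed.

Theorem proposition4p4 (d : measure_display) (T : measurableType d)
    (R : realType) (mu nu : {measure set T -> \bar R}) (A : set T)
    (hA : T -> \bar R)
    (compat : compatible mu nu)
    (finA : (finite_measure_sets mu `&` finite_measure_sets nu) A)
    (hAH : int_le_class mu nu hA)
    (hAsup : \int[mu]_(x in A) hA x =
             ereal_sup [set \int[mu]_(x in A) h x | h in int_le_class mu nu]) :
  nu A = \int[mu]_(x in A) hA x /\
  \int[mu]_(x in A) hA x =
    ereal_sup [set \int[mu]_(x in A) h x | h in int_le_class mu nu].
Proof.
split=> //; have [[mA muAoo] [_ nuAoo]] := finA.
have [_ _ _ hA_le] := hAH.
apply/eqP; rewrite eq_le hA_le// andbT.
have null N : measurable N -> N `<=` A -> mu N = 0 -> nu N = 0.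
  move=> mN NA; apply: compatible_null => //.
  by apply: le_lt_trans nuAoo; rewrite le_measure ?inE.
have [h [mh h_ge0 hA_supp hE]] :=
  exists_density_on _ _ _ _ _ _ mA muAoo nuAoo null.
rewrite hAsup; apply: ereal_sup_ubound; exists h; last by rewrite hE// setIid.
split=> //.
- have mpos : measurable [set x | 0 < h x].
    by rewrite -[X in measurable X]setTI; exact: emeasurable_fun_o_infty.
  by split=> //; apply: le_lt_trans muAoo; rewrite le_measure ?inE.
- by move=> M mM; rewrite hE// measureIl.
Qed.
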